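(* Let $u=\exp(2\pi i/3)$ and $\bar u$ its complex conjugate. There are exactly $84$ $3$-unital functions, and the set $\mathsf{U}_3$ of all $3$-unital functions is \[ \mathsf{U}_3=\langle x^3\rangle_6\cup\left\langle \tfrac{(1-\bar u)x}{x-u}\right\rangle_6\cup\bigcup_{\varepsilon\in\{1,u,\bar u\}}\left( \langle \varepsilon x\rangle_6\cup\left\langle \tfrac{1-u}{\varepsilon x-u}\right\rangle_6\cup\left\langle \tfrac{1-u\varepsilon x}{1-\varepsilon x}\right\rangle_6\cup\left\langle \tfrac{-3\varepsilon x}{(\varepsilon x-1)^2}\right\rangle_6\right). \]
   Context: Let $N$ be a positive integer. A non-constant rational function $U(x)\in\mathbb{C}(x)$ is called $N$-unital if all the zeros and poles (in $\mathbb{C}$) of both $U(x)$ and $1-U(x)$ are either $0$ or $N$-th roots of unity. For a rational function $f$, its $S_3$-orbit is the set \[ \langle f\rangle_6=\left\{ f,\ 1-f,\ \tfrac{1}{f},\ \tfrac{f}{f-1},\ \tfrac{f-1}{f},\ \tfrac{-1}{f-1}\right\}. \]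
   Formalization: The second generator (1-ū)x/(x-u) is replaced by ū(1-x)/(x-u): the printed one lies in the orbit of (1-uεx)/(1-εx) for ε=u, so the printed union has only 78 functions and misses the 3-unital function ū(1-x)/(x-u). *)

(* Defs.v *)
From HB Require Import structures.
From mathcomp Require Import all_boot all_order all_algebra.
From mathcomp Require Import fraction.
From mathcomp Require Import complex.
From mathcomp Require Import classical_sets functions cardinality reals sequences trigo.

Set Implicit Arguments.
Unset Strict Implicit.
Unset Printing Implicit Defensive.

Import Order.TTheory GRing.Theory Num.Theory.

Local Open Scope classical_set_scope.
Local Open Scope ring_scope.

Section RationalFunctions.
Variable F : fieldType.
Implicit Types (f : {fraction {poly F}}) (a c : F) (p q : {poly F}).

Definition rf_const c : {fraction {poly F}} := tofrac c%:P.
Definition rf_X : {fraction {poly F}} := tofrac 'X.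

Definition is_constant f : Prop := exists c, f = rf_const c.

(* The numerator and denominator of the library's representatives of a
   fraction need not be coprime, so zeros and poles are read off an arbitrary
   presentation in lowest terms. *)
Definition lowest_terms f p q : Prop :=
  [/\ q != 0, coprimep p q & f = tofrac p / tofrac q].

Definition is_zero f a : Prop :=
  exists p q, lowest_terms f p q /\ root p a.

Definition is_pole f a : Prop :=
  exists p q, lowest_terms f p q /\ root q a.

(* Meaningful for 0 < N only: every element is a 0-th root of unity. *)
Definition unital (N : nat) f : Prop :=
  ~ is_constant f /\
  forall a, is_zero f a \/ is_pole f a \/ is_zero (1 - f) a \/ is_pole (1 - f) a ->
    a = 0 \/ N.-unity_root a.

Definition orbit6 f : set {fraction {poly F}} :=
  [set f; 1 - f; 1 / f; f / (f - 1); (f - 1) / f; - 1 / (f - 1)].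

End RationalFunctions.

Definition cexp (R : realType) (z : R[i]) : R[i] :=
  Complex (expR (complex.Re z) * cos (complex.Im z))
          (expR (complex.Re z) * sin (complex.Im z)).

Definition zeta3 (R : realType) : R[i] :=
  cexp (2 * Complex pi 0 * Complex 0 1 / 3).

(* The right-hand side for U_3.  The second generator is ubar (1 - x) / (x - u).
   The source prints (1 - ubar) x / (x - u), a slip: that function equals
   (h - 1) / h for h = (1 - u e x) / (1 - e x) with e = u, so it already lies in
   a later orbit, the printed union has only 78 elements, and the six 3-unital
   functions in the orbit of ubar (1 - x) / (x - u) are missing from it. *)
Definition U3_list (R : realType) : set {fraction {poly R[i]}} :=
  let x := rf_X R[i] in
  let u := rf_const (zeta3 R) in
  let ubar := rf_const (conjc (zeta3 R)) in
  orbit6 (x ^+ 3)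
  `|` orbit6 (ubar * (1 - x) / (x - u))
  `|` \bigcup_(e in [set 1; u; ubar])
        (orbit6 (e * x)
         `|` orbit6 ((1 - u) / (e * x - u))
         `|` orbit6 ((1 - u * e * x) / (1 - e * x))
         `|` orbit6 (- 3 * e * x / (e * x - 1) ^+ 2)).

Arguments U3_list : clear implicits.

(* Main.v *)
(* Write an N-unital function in lowest terms as A / C and put B = C - A, so
   that A + B = C with A, B, C pairwise coprime and all their roots among 0 and
   the N-th roots of unity.  For N = 3 there are four such points, and the
   Mason-Stothers inequality bounds the degrees of A, B and C by 3.  Hence A, B
   and C are, up to constants, monomials in X, X - 1, X - w, X - w^2 whose
   exponent vectors range over a finite set.  The three monomials are linearly
   dependent, so the determinant of their values at 2, -1 and 3, an element of
   Z[w], vanishes; exactly 84 triples of exponent vectors pass this test.  A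
   triple determines the function, because a linear relation between two
   coprime polynomials is trivial. *)
Require Import Defs.
From Corelib Require Import BinNums.
From HB Require Import structures.
From mathcomp Require Import all_boot all_order all_algebra.
From mathcomp Require Import fraction complex ssrZ zify ring lra.
From mathcomp Require Import classical_sets functions cardinality reals sequences exp trigo.
Set Implicit Arguments.
Unset Strict Implicit.
Unset Printing Implicit Defensive.

Import Order.TTheory GRing.Theory Num.Theory.
Local Open Scope classical_set_scope.
Local Open Scope ring_scope.

(** * Wronskians of polynomials in characteristic zero *)

Section Wronskian.
Variable R : numDomainType.
Implicit Types p q : {poly R}.

(** In characteristic zero the top coefficient of the derivative is the degree times the leading
    coefficient, nonzero as soon as the degree is positive. *)
Lemma deriv_eq0_size p : p^`() = 0 -> (size p <= 1)%N.
Proof.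
move=> dp0; rewrite leqNgt; apply/negP => sp.
have: p^`()`_(size p).-2 = 0 by rewrite dp0 coef0.
rewrite coef_deriv => /eqP.
rewrite (_ : (size p).-2.+1 = (size p).-1); last by case: (size p) sp => [|[]].
rewrite mulrn_eq0; apply/negP; rewrite negb_or.
rewrite -lead_coefE lead_coef_eq0 -size_poly_gt0 (ltnW sp) andbT.
by case: (size p) sp => [|[]].
Qed.

Definition wronskian p q := p * q^`() - p^`() * q.

Lemma size_wronskian p q : p != 0 -> q != 0 ->
  ((size (wronskian p q)).+2 <= size p + size q)%N.
Proof.
move=> p0 q0.
have sp : (0 < size p)%N by rewrite size_poly_gt0.
have sq : (0 < size q)%N by rewrite size_poly_gt0.
have h1 : (size (p * q^`())%R <= (size p + size q).-2)%N.
  apply: leq_trans (size_polyMleq _ _) _.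
  by have := lt_size_deriv q0; lia.
have h2 : (size (p^`() * q)%R <= (size p + size q).-2)%N.
  apply: leq_trans (size_polyMleq _ _) _.
  by have := lt_size_deriv p0; lia.
have := size_polyD (p * q^`()) (- (p^`() * q)).
rewrite size_polyN -/(wronskian p q).
by move/leq_trans/(_ (_ : (_ <= (size p + size q).-2)%N)); rewrite geq_max h1 h2 => /(_ isT); lia.
Qed.

Lemma wronskian_addl p q : wronskian (p + q) q = wronskian p q.
Proof. by rewrite /wronskian derivD; ring. Qed.

Lemma wronskian_addr p q : wronskian p (p + q) = wronskian p q.
Proof. by rewrite /wronskian derivD; ring. Qed.

End Wronskian.

(** If the Wronskian vanishes, coprimality makes each polynomial divide its own derivative, which
    has smaller degree; so both derivatives are zero. *)
Lemma wronskian_neq0 (F : numFieldType) (p q : {poly F}) :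
  coprimep p q -> ~ ((size p <= 1)%N /\ (size q <= 1)%N) -> wronskian p q != 0.
Proof.
move=> cpq; apply: contra_notN => /eqP /subr0_eq e.
have small (r s : {poly F}) : r %| s^`() -> (size s <= size r)%N -> s != 0 -> s^`() = 0.
  move=> rs ss s0; apply/eqP; apply: contraTT rs => ds0.
  apply/negP => /(dvdp_leq ds0).
  by rewrite leqNgt (leq_trans (lt_size_deriv s0)).
split; apply: deriv_eq0_size.
- have [->|p0] := eqVneq p 0; first by rewrite deriv0.
  apply: (small p) => //.
  by rewrite -(Gauss_dvdpl _ cpq) -e dvdp_mulr.
- have [->|q0] := eqVneq q 0; first by rewrite deriv0.
  apply: (small q) => //.
  by rewrite -(@Gauss_dvdpr _ _ p) 1?coprimep_sym // e dvdp_mull.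
Qed.

(** * The Mason-Stothers inequality *)

Section Mason.
Variable F : numClosedFieldType.
Implicit Types (p q r A B C P : {poly F}) (s : seq F).

(** Differentiation lowers the multiplicity of a root by at most one, and [P] supplies the missing
    factor. The induction peels off one linear factor of [p] at a time. *)
Lemma dvdp_deriv_mul p P : p != 0 ->
  (forall x, root p x -> root P x) -> p %| p^`() * P.
Proof.
have [n] := ubnP (size p); elim: n p => // n IH p spn p0 hp.
have [sp1|sp1] := eqVneq (size p) 1%N.
  by move/eqP: sp1; rewrite size_poly_eq1 => /eqp_dvdl ->; rewrite dvd1p.
have /closed_rootP [x px] := sp1.
have /factor_theorem [P1 eP] := hp x px.
have /factor_theorem [q eq] := px.
move: p0; rewrite eq mulf_eq0 negb_or => /andP [q0 X0].
rewrite derivM derivXsubC mulr1 mulrDl dvdp_add //; last first.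
  by rewrite eP (mulrCA q) dvdp_mull.
rewrite -mulrA (mulrC ('X - _)) mulrA dvdp_mul // IH //.
  by move: spn; rewrite eq size_Mmonic ?monicXsubC // size_XsubC addnS addn1.
by move=> y qy; apply: hp; rewrite eq rootM qy.
Qed.

Lemma dvdp_wronskianl A B P : A != 0 ->
  (forall x, root A x -> root P x) -> A %| wronskian A B * P.
Proof.
move=> A0 hA; rewrite /wronskian mulrBl dvdp_sub //.
  by rewrite -mulrA dvdp_mulr.
by rewrite mulrAC dvdp_mulr // dvdp_deriv_mul.
Qed.

Lemma dvdp_wronskianr A B P : B != 0 ->
  (forall x, root B x -> root P x) -> B %| wronskian A B * P.
Proof.
move=> B0 hB; rewrite (_ : wronskian A B = - wronskian B A).
  by rewrite mulNr dvdpNr dvdp_wronskianl.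
by rewrite /wronskian; ring.
Qed.

(* Mason-Stothers: [A * B * C] divides the Wronskian times the radical, and the
   Wronskian can be computed from any two of [A], [B], [C]. *)
Lemma mason_stothers s A B C : A + B = C ->
  A != 0 -> B != 0 -> C != 0 ->
  coprimep A B -> coprimep A C -> coprimep B C ->
  ~ ((size A <= 1)%N /\ (size B <= 1)%N) ->
  (forall x, root (A * B * C) x -> x \in s) ->
  [/\ (size A <= size s)%N, (size B <= size s)%N & (size C <= size s)%N].
Proof.
move=> eC A0 B0 C0 cAB cAC cBC nc hs.
pose P := \prod_(z <- s) ('X - z%:P).
have P0 : P != 0 by rewrite monic_neq0 // monic_prod_XsubC.
have sP : size P = (size s).+1 by rewrite size_prod_XsubC.
have rP x : root A x || root B x || root C x -> root P x.
  by move=> h; rewrite root_prod_XsubC hs // !rootM.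
pose W := wronskian A B.
have W0 : W != 0 by apply: wronskian_neq0.
have WAC : W = wronskian A C by rewrite -eC wronskian_addr.
have WCB : W = wronskian C B by rewrite -eC wronskian_addl.
have: A * B * C %| W * P.
  rewrite Gauss_dvdp ?coprimepMl ?cAC // Gauss_dvdp // -andbA; apply/and3P; split.
  - by apply: dvdp_wronskianl => // x h; apply: rP; rewrite h.
  - by apply: dvdp_wronskianr => // x h; apply: rP; rewrite h orbT.
  - by rewrite WAC; apply: dvdp_wronskianr => // x h; apply: rP; rewrite h orbT.
move/dvdp_leq; rewrite !size_mul ?mulf_neq0 // sP => /(_ isT).
have sA : (0 < size A)%N by rewrite size_poly_gt0.
have sB : (0 < size B)%N by rewrite size_poly_gt0.
have sC : (0 < size C)%N by rewrite size_poly_gt0.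
(* The divisibility gives [a + b + c - 2 <= w + n] for the sizes. Bounding [w] by the sizes of two
   of the polynomials leaves [n] as a bound for the third. *)
have := size_wronskian A0 B0; rewrite -/W.
have := size_wronskian A0 C0; rewrite -WAC.
have := size_wronskian C0 B0; rewrite -WCB.
move: sA sB sC; move: (size A) (size B) (size C) (size W) (size s) => a b c w n.
by move=> *; split; lia.
Qed.

End Mason.

(** * Polynomials with roots in a given list, encoded by exponent vectors *)

Section Monomials.
Variable F : fieldType.
Implicit Types (s : seq F) (e a b : seq nat) (p : {poly F}).

Definition mon s e : {poly F} :=
  \prod_(z <- zip s e) ('X - z.1%:P) ^+ z.2.

Lemma mon_cons x s k e : mon (x :: s) (k :: e) = ('X - x%:P) ^+ k * mon s e.
Proof. by rewrite /mon /= big_cons. Qed.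

Lemma mon_monic s e : mon s e \is monic.
Proof. by apply: monic_prod => z _; rewrite monic_exp ?monicXsubC. Qed.

Lemma mon_neq0 s e : mon s e != 0.
Proof. exact/monic_neq0/mon_monic. Qed.

Lemma size_mon s e : size e = size s -> size (mon s e) = (sumn e).+1.
Proof.
elim: s e => [|x s IH] [|k e] //; first by rewrite /mon big_nil size_poly1.
move=> [/IH h]; rewrite mon_cons size_monicM ?mon_neq0 ?monic_exp ?monicXsubC //.
by rewrite h size_exp_XsubC /=; lia.
Qed.

Lemma root_mon s e x : root (mon s e) x -> x \in s.
Proof.
elim: s e => [|y s IH] [|k e]; try by rewrite /mon /= big_nil (negPf (root1 _)).
rewrite mon_cons rootM inE => /orP [h|/IH ->]; last by rewrite orbT.
apply/orP; left; case: k h => [|k]; first by rewrite expr0 (negPf (root1 _)).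
by rewrite root_exp_XsubC.
Qed.

Lemma mup_mon s e : uniq s -> size e = size s -> [seq mup x (mon s e) | x <- s] = e.
Proof.
elim: s e => [|x s IH] [|k e] //= /andP [xs us] [se].
have X0 y : ('X - x%:P) ^+ y != 0 by rewrite expf_neq0 ?polyXsubC_eq0.
congr cons.
  rewrite mon_cons mupM ?mon_neq0 // mup_XsubCX eqxx mupNroot ?addn0 //.
  by apply: contra xs => /root_mon.
rewrite -[RHS](IH e us se); apply/eq_in_map => y ys.
rewrite mon_cons mupM ?mon_neq0 // mup_XsubCX.
by case: eqP => // xy; move: xs; rewrite xy ys.
Qed.

(** Associate monic polynomials are equal, and the exponents are recovered as root
    multiplicities. *)
Lemma mon_eqp_inj s a b : uniq s -> size a = size s -> size b = size s ->
  mon s a %= mon s b -> a = b.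
Proof.
move=> us sa sb; rewrite eqp_monic ?mon_monic // => /eqP e.
by rewrite -(mup_mon us sa) e mup_mon.
Qed.

Definition disj a b := all (fun z => (z.1 == 0%N) || (z.2 == 0%N)) (zip a b).

Lemma coprimep_mon s a b : uniq s -> size a = size s -> size b = size s ->
  coprimep (mon s a) (mon s b) = disj a b.
Proof.
elim: s a b => [|x s IH] [|k a] [|l b] //=.
  by rewrite /mon big_nil coprimep1.
move=> /andP [xs us] [sa] [sb].
have cX e j : coprimep (mon s e) (('X - x%:P) ^+ j).
  by rewrite coprimep_expr // coprimep_XsubC; apply: contra xs => /root_mon.
rewrite !mon_cons coprimepMl !coprimepMr cX IH //.
rewrite [coprimep (_ ^+ _) (mon s b)]coprimep_sym cX andbT.
rewrite /disj /=; congr andb.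
case: k l => [|k] [|l] /=; rewrite ?expr0 ?coprime1p ?coprimep1 //.
apply: negbTE; rewrite coprimep_pexpl // coprimep_pexpr //.
by rewrite coprimep_XsubC root_XsubC eqxx.
Qed.

End Monomials.

(** Split off the full power of each listed point in turn; what remains has no root, hence is
    constant over an algebraically closed field. *)
Lemma eqp_mon (F : closedFieldType) (s : seq F) (p : {poly F}) : p != 0 ->
  (forall x, root p x -> x \in s) -> exists2 e, size e = size s & p %= mon s e.
Proof.
elim: s p => [|x s IH] p p0 hp.
  exists [::] => //; rewrite /mon big_nil -size_poly_eq1.
  by apply: contraT => /closed_rootP [x /hp].
have [k [q]] := multiplicity_XsubC p x; rewrite p0 /= => qx ep.
have q0 : q != 0 by apply: contraNneq p0 => q0; rewrite ep q0 mul0r.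
have [|e se qe] := IH q q0.
  move=> y qy; have /hp : root p y by rewrite ep rootM qy.
  by rewrite inE => /orP [/eqP yx|//]; move: qx; rewrite -yx qy.
exists (k :: e); first by rewrite /= se.
by rewrite mon_cons ep mulrC eqp_mull.
Qed.

(** * Computable arithmetic in [Z[w]] and the linear dependence test *)

Section Eisenstein.
Variables (F : numFieldType) (w : F).
Hypothesis w2 : w ^+ 2 = - w - 1.

(* The pair [(a, b)] encodes [a + b w]. *)
Definition eis_mul (x y : Z * Z) : Z * Z :=
  (x.1 * y.1 - x.2 * y.2, x.1 * y.2 + x.2 * y.1 - x.2 * y.2).

Definition eis_val (x : Z * Z) : F :=
  (int_of_Z x.1)%:~R + (int_of_Z x.2)%:~R * w.

Lemma eis_valD x y : eis_val (x + y) = eis_val x + eis_val y.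
Proof.
rewrite /eis_val -[(x + y).1]/(x.1 + y.1) -[(x + y).2]/(x.2 + y.2).
by rewrite !(rmorphD int_of_Z) !rmorphD /=; ring.
Qed.

Lemma eis_valN x : eis_val (- x) = - eis_val x.
Proof.
rewrite /eis_val -[(- x).1]/(- x.1) -[(- x).2]/(- x.2).
by rewrite !(rmorphN int_of_Z) !rmorphN /=; ring.
Qed.

Lemma eis_valM x y : eis_val (eis_mul x y) = eis_val x * eis_val y.
Proof.
rewrite /eis_val -[(eis_mul x y).1]/(x.1 * y.1 - x.2 * y.2).
rewrite -[(eis_mul x y).2]/(x.1 * y.2 + x.2 * y.1 - x.2 * y.2).
rewrite !(rmorphB int_of_Z, rmorphD int_of_Z, rmorphM int_of_Z) !(intrB, intrD, intrM).
by ring: w2.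
Qed.

(* The norm form [a^2 - a b + b^2] has no nontrivial integer zero. *)
Lemma eis_val_eq0 x : eis_val x = 0 -> x = (0, 0).
Proof.
case: x => a b; rewrite /eis_val /= => h.
set m := int_of_Z a in h; set n := int_of_Z b in h.
have: ((m ^+ 2 - m * n + n ^+ 2)%:~R : F) = 0.
  rewrite !(intrB, intrD, intrM, rmorphXn) /=.
  (* The second factor is the conjugate of the first, with [w] replaced by [w ^+ 2 = - w - 1]. *)
  transitivity ((m%:~R + n%:~R * w) * (m%:~R - n%:~R - n%:~R * w)); first by ring: w2.
  by rewrite h mul0r.
move/eqP; rewrite intr_eq0 => /eqP hmn.
have m0 : m = 0 by nia.
have n0 : n = 0 by nia.
by rewrite -(int_of_ZK a) -(int_of_ZK b) -/m -/n m0 n0.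
Qed.

(** The last pair encodes [w ^+ 2], which equals [- 1 - w]. *)
Definition eis_pts : seq (Z * Z) :=
  [:: (0, 0); (1, 0); (0, 1); (-1, -1)].

Definition eis_eval (t : Z * Z) (e : seq nat) : Z * Z :=
  foldr (fun z r => iter z.2 (eis_mul (t - z.1)) r) (1, 0) (zip eis_pts e).

Lemma eis_val_pts : map eis_val eis_pts = [:: 0; 1; w; w ^+ 2].
Proof.
by rewrite /eis_val /= -[BinPos.Pos.to_nat _]/1%N w2; congr [:: _; _; _; _]; ring.
Qed.

Lemma eis_val1 : eis_val (1, 0) = 1.
Proof. by rewrite /eis_val /= -[BinPos.Pos.to_nat _]/1%N; ring. Qed.

Lemma eis_val_eval t e :
  eis_val (eis_eval t e) = (mon [:: 0; 1; w; w ^+ 2] e).[eis_val t].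
Proof.
rewrite -eis_val_pts /eis_eval /mon.
elim: eis_pts e => [|z s IH] [|k e] /=; rewrite ?big_nil ?hornerC ?eis_val1 //.
rewrite big_cons hornerM -IH horner_exp !hornerE -eis_valN -eis_valD.
elim: k => [|k IHk] /=; first by rewrite expr0 mul1r.
by rewrite eis_valM IHk exprS mulrA.
Qed.

(** Cofactor expansion of the 3 by 3 determinant with rows [f], [g], [h]. *)
Definition eis_det (f1 f2 f3 g1 g2 g3 h1 h2 h3 : Z * Z) : Z * Z :=
  eis_mul f1 (eis_mul g2 h3 - eis_mul g3 h2)
  + eis_mul f2 (eis_mul g3 h1 - eis_mul g1 h3)
  + eis_mul f3 (eis_mul g1 h2 - eis_mul g2 h1).

(** A necessary condition for dependence, sampled at three integers outside the four special points.
    That it excludes every unwanted candidate is checked by computation. *)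
Definition eis_dep (a b c : seq nat) : bool :=
  eis_det (eis_eval (2, 0) a) (eis_eval (-1, 0) a) (eis_eval (3, 0) a)
    (eis_eval (2, 0) b) (eis_eval (-1, 0) b) (eis_eval (3, 0) b)
    (eis_eval (2, 0) c) (eis_eval (-1, 0) c) (eis_eval (3, 0) c) == (0, 0).

(** Scaling the determinant by [k != 0] lets its first row be replaced by a combination of the other
    two, which makes it vanish. *)
Lemma eis_dep_mon a b c (A B C : {poly F}) : A + B = C ->
  A %= mon [:: 0; 1; w; w ^+ 2] a -> B %= mon [:: 0; 1; w; w ^+ 2] b ->
  C %= mon [:: 0; 1; w; w ^+ 2] c -> eis_dep a b c.
Proof.
move=> eC /eqpf_eq [k k0 eA] /eqpf_eq [l l0 eB] /eqpf_eq [m m0 em].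
apply/eqP; apply: eis_val_eq0; apply: (mulfI k0); rewrite mulr0.
rewrite !(eis_valD, eis_valN, eis_valM) !eis_val_eval.
have rel t : k * (mon [:: 0; 1; w; w ^+ 2] a).[t] =
    m * (mon [:: 0; 1; w; w ^+ 2] c).[t] - l * (mon [:: 0; 1; w; w ^+ 2] b).[t].
  by rewrite -!hornerZ -eA -eB -em -eC hornerD addrK.
by rewrite !mulrDr !mulrA !rel; ring.
Qed.

End Eisenstein.

(* Exponents of the zeros, the ones and the poles of a function at the points
   [0], [1], [w], [w ^+ 2], in this order. *)
Notation triple := (seq nat * seq nat * seq nat)%type.

(** * The finite search over exponent vectors *)

Fixpoint vecs (n k : nat) : seq (seq nat) :=
  if n is m.+1 then
    flatten [seq [seq j :: v | v <- vecs m (k - j)] | j <- iota 0 k.+1]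
  else [:: [::]].

Lemma mem_vecs n k e : size e = n -> (sumn e <= k)%N -> e \in vecs n k.
Proof.
elim: n k e => [|n IH] k [|j e] // [se] sk.
have {}sk : (j + sumn e <= k)%N := sk.
have -> : vecs n.+1 k =
  flatten [seq [seq j :: v | v <- vecs n (k - j)] | j <- iota 0 k.+1] by [].
apply/flattenP; exists [seq j :: v | v <- vecs n (k - j)].
  by apply: (map_f (fun j => [seq j :: v | v <- vecs n (k - j)])); rewrite mem_iota; lia.
by apply: map_f; apply: IH => //; lia.
Qed.

(** The order is that of the six functions in [orbit6]: each of them permutes zeros, ones and
    poles. *)
Definition perm6 (t : triple) : seq triple :=
  let: (a, b, c) := t in
  [:: (a, b, c); (b, a, c); (c, b, a); (a, c, b); (b, c, a); (c, a, b)].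

Definition gen_triples : seq triple :=
  [:: ([:: 3; 0; 0; 0], [:: 0; 1; 1; 1], [:: 0; 0; 0; 0]);
      ([:: 0; 1; 0; 0], [:: 0; 0; 0; 1], [:: 0; 0; 1; 0]);
      ([:: 1; 0; 0; 0], [:: 0; 1; 0; 0], [:: 0; 0; 0; 0]);
      ([:: 0; 0; 0; 0], [:: 0; 1; 0; 0], [:: 0; 0; 1; 0]);
      ([:: 0; 0; 0; 1], [:: 1; 0; 0; 0], [:: 0; 1; 0; 0]);
      ([:: 1; 0; 0; 0], [:: 0; 0; 1; 1], [:: 0; 2; 0; 0]);
      ([:: 1; 0; 0; 0], [:: 0; 0; 0; 1], [:: 0; 0; 0; 0]);
      ([:: 0; 0; 0; 0], [:: 0; 0; 0; 1], [:: 0; 1; 0; 0]);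
      ([:: 0; 0; 1; 0], [:: 1; 0; 0; 0], [:: 0; 0; 0; 1]);
      ([:: 1; 0; 0; 0], [:: 0; 1; 1; 0], [:: 0; 0; 0; 2]);
      ([:: 1; 0; 0; 0], [:: 0; 0; 1; 0], [:: 0; 0; 0; 0]);
      ([:: 0; 0; 0; 0], [:: 0; 0; 1; 0], [:: 0; 0; 0; 1]);
      ([:: 0; 1; 0; 0], [:: 1; 0; 0; 0], [:: 0; 0; 1; 0]);
      ([:: 1; 0; 0; 0], [:: 0; 1; 0; 1], [:: 0; 0; 2; 0])]%N.

(** The index [6 * j + k] stands for the [k]-th permutation of the [j]-th generator. *)
Definition orbit_triple (i : nat) : triple :=
  nth ([::], [::], [::]) (perm6 (nth ([::], [::], [::]) gen_triples (i %/ 6))) (i %% 6).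

(** Disjoint supports express coprimality. The last condition expresses that the function is not
    constant: in [A + B = C], a single non-constant term is impossible. *)
Definition admissible (t : triple) : bool :=
  let: (a, b, c) := t in
  [&& disj a b, disj a c, disj b c &
      (1 < (0 < sumn a) + (0 < sumn b) + (0 < sumn c))%N].

Lemma uniq_orbit_triple : uniq (mkseq orbit_triple 84).
Proof. by vm_compute. Qed.

Lemma admissible_orbit_triple i : (i < 84)%N ->
  let: (a, b, c) := orbit_triple i in
  [/\ admissible (orbit_triple i), size a = 4%N, size b = 4%N & size c = 4%N].
Proof.
have: all (fun t => let: (a, b, c) := t in
    [&& admissible t, size a == 4%N, size b == 4%N & size c == 4%N]) (mkseq orbit_triple 84).
  by vm_compute.
move=> /allP h i84; have := h (orbit_triple i); rewrite map_f ?mem_iota // => /(_ isT).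
by case: (orbit_triple i) => [[a b] c] /and4P [? /eqP ? /eqP ? /eqP ?].
Qed.

Lemma eis_dep_orbit_triple a b c : admissible (a, b, c) -> eis_dep a b c ->
  a \in vecs 4 3 -> b \in vecs 4 3 -> c \in vecs 4 3 ->
  exists2 i, (i < 84)%N & orbit_triple i = (a, b, c).
Proof.
(* The nested conditionals keep [vm_compute] from evaluating the determinants
   of the inadmissible triples, which [==>] would not. *)
have: all (fun a => all (fun b => if disj a b then
    all (fun c => if admissible (a, b, c) then
      if eis_dep a b c then (a, b, c) \in mkseq orbit_triple 84 else true
    else true) (vecs 4 3) else true) (vecs 4 3)) (vecs 4 3).
  by vm_compute.
move=> /allP h ad dep /h /allP {}h /h.
case/and4P: (ad) => -> _ _ _ /allP {}h /h; rewrite ad dep.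
by move=> /mapP [j]; rewrite mem_iota => /= j84 ->; exists j.
Qed.

(* Stated over an abstract field because [field] does not terminate on
   [{fraction {poly F}}]. *)
Lemma orbit_quotients (K : fieldType) (a b c : K) : a + b = c ->
  a != 0 -> b != 0 -> c != 0 ->
  [/\ 1 - a / c = b / c, 1 / (a / c) = c / a, a / c / (a / c - 1) = a / - b,
      (a / c - 1) / (a / c) = b / - a & - 1 / (a / c - 1) = c / b].
Proof.
move=> ec a0 b0 c0; have e : a / c - 1 = - b / c.
  by rewrite (canRL (addrK _) ec); field.
rewrite e; split; first by rewrite (canRL (addrK _) ec); field.
all: field; rewrite ?oppr_eq0 ?a0 ?b0 ?c0.
all: by [].
Qed.

Lemma frac_quotient (R : idomainType) (f : {fraction R}) :
  exists n d : R, d != 0 /\ f = tofrac n / tofrac d.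
Proof.
elim/quotW: f => r; have d0 := denom_ratioP r.
exists (frac r).1, (frac r).2; split=> //.
apply: (canRL (mulfK _)); first by rewrite tofrac_eq0.
unlock tofrac; rewrite -[LHS]FracField.pi_mul.
apply/eqmodP; rewrite /= FracField.equivfE /FracField.mulf.
by rewrite !numden_Ratio ?mulf_neq0 ?oner_eq0 // !mulr1 mulrC.
Qed.

Lemma eqpNp (R : idomainType) (p : {poly R}) : - p %= p.
Proof. by rewrite -scaleN1r eqp_scale // oppr_eq0 oner_eq0. Qed.

(** * Functions represented by triples of exponent vectors *)

Section Representation.
Variables (F : numClosedFieldType) (w : F).
Hypotheses (w2 : w ^+ 2 = - w - 1).
Implicit Types (A B C p q : {poly F}) (f g : {fraction {poly F}}) (t : triple).

Notation s := [:: 0; 1; w; w ^+ 2].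
Notation "p %:F" := (@tofrac {poly F} p).

Lemma w_neq0 : w != 0.
Proof.
apply: contra_eqN w2 => /eqP ->.
by rewrite expr0n /= oppr0 add0r eq_sym oppr_eq0 oner_eq0.
Qed.

Lemma w_neq1 : w != 1.
Proof.
apply: contra_eqN w2 => /eqP ->; rewrite -subr_eq0.
by rewrite (_ : _ - _ = 3) ?pnatr_eq0 //; ring.
Qed.

Lemma w3 : w ^+ 3 = 1.
Proof. by rewrite exprS; ring: w2. Qed.

Lemma uniq_s : uniq s.
Proof.
have w0 := w_neq0; have w1 := w_neq1.
have w21 : w ^+ 2 != 1.
  by apply: contraNneq w1 => h; rewrite -w3 exprS h mulr1.
have ww2 : w != w ^+ 2.
  by apply: contraNneq w1 => h; apply/eqP/(mulfI w0); rewrite mulr1 -expr2.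
by rewrite /= !inE !negb_or !(eq_sym 0) oner_eq0 w0 expf_neq0 // !(eq_sym 1) w1 w21 ww2.
Qed.

Lemma mem_s x : x \in s <-> x = 0 \/ 3.-unity_root x.
Proof.
rewrite !inE; split.
  move=> /or4P [] /eqP ->; [by left| | |]; right; apply/unity_rootP;
    rewrite ?expr1n ?w3 //.
  by rewrite exprAC w3 expr1n.
move=> [->|/unity_rootP h]; first by rewrite eqxx.
have : (x - 1) * (x - w) * (x - w ^+ 2) = 0.
  transitivity (x ^+ 3 - 1); last by rewrite h subrr.
  by ring: w2.
by move/eqP; rewrite !mulf_eq0 !subr_eq0 => /orP [/orP []|] ->; rewrite ?orbT.
Qed.

(** Here [B / C] is [1 - f]. Working up to associates leaves the constant factors of [A], [B], [C]
    free. *)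
Definition represents f t : Prop :=
  let: (a, b, c) := t in exists A B C,
  [/\ A + B = C, A %= mon s a, B %= mon s b, C %= mon s c & f = A%:F / C%:F].

Lemma eqp_mon_neq0 p e : p %= mon s e -> p != 0.
Proof. by move=> h; rewrite -size_poly_eq0 (eqp_size h) size_poly_eq0 mon_neq0. Qed.

Lemma frac_eq A C p q : C != 0 -> q != 0 ->
  A%:F / C%:F = p%:F / q%:F -> A * q = p * C.
Proof.
move=> C0 q0 /eqP; rewrite eqr_div ?tofrac_eq0 // -!tofracM tofrac_eq => /eqP.
by [].
Qed.

Definition orbit6_seq f : seq {fraction {poly F}} :=
  [:: f; 1 - f; 1 / f; f / (f - 1); (f - 1) / f; - 1 / (f - 1)].

(** Each of the six functions comes from rearranging [A + B = C] with suitable signs, and signs are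
    invisible up to associates. *)
Lemma represents_orbit f t k : represents f t -> (k < 6)%N ->
  represents (nth 0 (orbit6_seq f) k) (nth ([::], [::], [::]) (perm6 t) k).
Proof.
case: t => [[a b] c] [A [B [C [eC hA hB hC ->]]]].
have A0 : A%:F != 0 by rewrite tofrac_eq0 (eqp_mon_neq0 hA).
have B0 : B%:F != 0 by rewrite tofrac_eq0 (eqp_mon_neq0 hB).
have C0 : C%:F != 0 by rewrite tofrac_eq0 (eqp_mon_neq0 hC).
have hN p e : p %= mon s e -> - p %= mon s e.
  exact/eqp_trans/eqpNp.
have eF : A%:F + B%:F = C%:F by rewrite -tofracD eC.
have [e1 e2 e3 e4 e5] := orbit_quotients eF A0 B0 C0.
case: k => [|[|[|[|[|[|k]]]]]] //= _.
- by exists A, B, C.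
- by exists B, A, C; split=> //; rewrite addrC.
- by exists C, (- B), A; split; rewrite ?hN // -eC addrK.
- by exists A, (- C), (- B); split; rewrite ?hN ?tofracN // -eC opprD addNKr.
- exists B, (- C), (- A); split; rewrite ?hN ?tofracN // -eC (addrC A) opprD addNKr //.
- by exists C, (- A), B; split; rewrite ?hN // -eC addrC addKr.
Qed.

(** * Admissible triples give unital functions and determine them *)

Section Admissible.
Variables (a b c : seq nat).
Hypotheses (sa : size a = 4%N) (sb : size b = 4%N) (sc : size c = 4%N).
Hypothesis abc_adm : admissible (a, b, c).

Lemma represents_coprime A B C :
  A %= mon s a -> B %= mon s b -> C %= mon s c ->
  [/\ coprimep A B, coprimep A C, coprimep B C & ~ ((size A <= 1)%N /\ (size B <= 1)%N)].
Proof.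
case/and4P: abc_adm => dab dac dbc nt hA hB hC.
rewrite (eqp_coprimepl _ hA) (eqp_coprimepr _ hB) (eqp_coprimepl _ hA).
rewrite (eqp_coprimepr _ hC) (eqp_coprimepl _ hB) (eqp_coprimepr _ hC).
rewrite !coprimep_mon ?uniq_s // (eqp_size hA) (eqp_size hB) !size_mon //; split=> // -[].
by case: (sumn a) (sumn b) (sumn c) nt => [|?] [|?] [|?].
Qed.

Lemma represents_unital f : represents f (a, b, c) -> unital 3 f.
Proof.
move=> [A [B [C [eC hA hB hC ef]]]].
have [cAB cAC cBC nt] := represents_coprime hA hB hC.
have [A0 B0 C0] := And3 (eqp_mon_neq0 hA) (eqp_mon_neq0 hB) (eqp_mon_neq0 hC).
have CF0 : C%:F != 0 by rewrite tofrac_eq0.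
have e1f : 1 - f = B%:F / C%:F.
  have eF : A%:F + B%:F = C%:F by rewrite -tofracD eC.
  by rewrite ef; case: (orbit_quotients eF); rewrite ?tofrac_eq0.
split.
  (* If [f] were a constant [k], then [A] and [C] would be both associate and coprime, hence
     constant, and so would [B = C - A]. *)
  move=> [k]; rewrite ef /rf_const => /(canRL (mulfVK CF0)) /eqP.
  rewrite -tofracM tofrac_eq mul_polyC => /eqP eA; apply: nt.
  have k0 : k != 0 by apply: contraNneq A0 => k0; rewrite eA k0 scale0r.
  have eqAC : A %= C by rewrite eA eqp_scale.
  have sC : size C = 1%N.
    by apply/eqP; move: cAC; rewrite (eqp_coprimepl _ eqAC) coprimepp.
  split; first by rewrite (eqp_size eqAC) sC.
  have -> : B = C - A by rewrite -eC addrC addKr.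
  apply: leq_trans (size_polyD _ _) _.
  by rewrite size_polyN (eqp_size eqAC) sC.
(* Any presentation in lowest terms has numerator dividing [P] and denominator dividing [C], so its
   roots are already controlled. *)
have low g P p q : P != 0 -> g = P%:F / C%:F -> lowest_terms g p q -> p %| P /\ q %| C.
  move=> P0 eg [q0 cpq]; rewrite eg => /(frac_eq C0 q0) e; split.
    by rewrite -(Gauss_dvdpl _ cpq) e dvdp_mulr.
  by rewrite -(@Gauss_dvdpr _ _ p) 1?coprimep_sym // -e dvdp_mull.
have key p e x : p %= mon s e -> root p x -> x = 0 \/ 3.-unity_root x.
  by move=> h; rewrite (eqp_root h) => /root_mon /mem_s.
have sub p P x : p %| P -> root p x -> root P x.
  by move=> /dvdpP [r ->]; rewrite rootM orbC => ->.
move=> x [|[|[|]]] [p [q [h r]]].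
- by apply: key hA _; apply: sub r; case: (low _ _ _ _ A0 ef h).
- by apply: key hC _; apply: sub r; case: (low _ _ _ _ A0 ef h).
- by apply: key hB _; apply: sub r; case: (low _ _ _ _ B0 e1f h).
- by apply: key hC _; apply: sub r; case: (low _ _ _ _ B0 e1f h).
Qed.

(** Writing the second relation as [k A + l B = m (A + B)] gives [(k - m) A = (m - l) B]. As [A] and
    [B] are coprime and not both constant, [k = m], so the two quotients agree. *)
Lemma represents_fun f g : represents f (a, b, c) -> represents g (a, b, c) -> f = g.
Proof.
move=> [A [B [C [eC hA hB hC ->]]]] [A' [B' [C' [eC' hA' hB' hC' ->]]]].
have [cAB _ _ nt] := represents_coprime hA hB hC.
have tr p q e : p %= mon s e -> q %= mon s e -> p %= q.
  by move=> h; rewrite eqp_sym; apply: eqp_trans.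
have [k k0 eA] := eqpf_eq _ _ (tr _ _ _ hA' hA).
have [l l0 eB] := eqpf_eq _ _ (tr _ _ _ hB' hB).
have [m m0 em] := eqpf_eq _ _ (tr _ _ _ hC' hC).
have [A0 B0] := conj (eqp_mon_neq0 hA) (eqp_mon_neq0 hB).
have h : k *: A + l *: B = m *: A + m *: B.
  by rewrite -eA -eB eC' em -eC scalerDr.
have e : (k - m) *: A = (m - l) *: B.
  apply/eqP; rewrite !scalerBl subr_eq addrAC eq_sym subr_eq h.
  by rewrite addrC.
have km : k = m.
  apply/eqP; apply: contra_notT nt; rewrite -subr_eq0 => km.
  have ml : m - l != 0.
    apply: contraNneq A0 => ml; move/eqP: e; rewrite ml scale0r scaler_eq0.
    by rewrite (negPf km).
  have AB : A %= B.
    by rewrite -(eqp_ltrans (eqp_scale A km)) e eqp_scale.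
  have sB : size B = 1%N.
    by apply/eqP; move: cAB; rewrite (eqp_coprimepl _ AB) coprimepp.
  by rewrite (eqp_size AB) sB.
have mF : m%:P%:F != 0 by rewrite tofrac_eq0 polyC_eq0.
by rewrite eA em km -!mul_polyC !tofracM -mulf_div divff // mul1r.
Qed.

End Admissible.

(** Lowest terms are unique up to associates, and associates have the same exponent vector. *)
Lemma represents_triple f a b c a' b' c' :
  size a = 4%N -> size b = 4%N -> size c = 4%N ->
  size a' = 4%N -> size b' = 4%N -> size c' = 4%N ->
  admissible (a, b, c) -> admissible (a', b', c') ->
  represents f (a, b, c) -> represents f (a', b', c') -> (a, b, c) = (a', b', c').
Proof.
move=> sa sb sc sa' sb' sc' adm adm'.
move=> [A [B [C [eC hA hB hC ->]]]] [A' [B' [C' [eC' hA' hB' hC']]]].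
have [_ cAC cBC _] := represents_coprime sa sb sc adm hA hB hC.
have [_ cAC' cBC' _] := represents_coprime sa' sb' sc' adm' hA' hB' hC'.
have [C0 C0'] := conj (eqp_mon_neq0 hC) (eqp_mon_neq0 hC').
have assoc P P' : coprimep P C -> coprimep P' C' -> P * C' = P' * C -> P %= P'.
  move=> cP cP' e; apply/andP; split.
    by rewrite -(Gauss_dvdpl _ cP) -e dvdp_mulr.
  by rewrite -(Gauss_dvdpl _ cP') e dvdp_mulr.
have assocC P P' : coprimep P C -> coprimep P' C' -> P * C' = P' * C -> C %= C'.
  move=> cP cP' e; apply/andP; split.
    by rewrite -(@Gauss_dvdpr _ _ P) 1?coprimep_sym // e dvdp_mull.
  by rewrite -(@Gauss_dvdpr _ _ P') 1?coprimep_sym // -e dvdp_mull.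
move=> /(frac_eq C0 C0') eA.
have eB : B * C' = B' * C.
  have -> : B = C - A by rewrite -eC addrC addKr.
  have -> : B' = C' - A' by rewrite -eC' addrC addKr.
  by rewrite !mulrBl eA (mulrC C).
have inj e e' p p' : size e = 4%N -> size e' = 4%N -> p %= mon s e ->
    p' %= mon s e' -> p %= p' -> e = e'.
  move=> se se' h h' pp'; apply: (mon_eqp_inj uniq_s) => //.
  by rewrite -(eqp_ltrans h) (eqp_trans pp').
congr (_, _, _).
- exact: inj hA hA' (assoc _ _ cAC cAC' eA).
- exact: inj hB hB' (assoc _ _ cBC cBC' eB).
- exact: inj hC hC' (assocC _ _ cAC cAC' eA).
Qed.

Lemma lowest_terms_exists f : exists p q, lowest_terms f p q.
Proof.
have [n [d [d0 ->]]] := frac_quotient f.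
have g0 : gcdp n d != 0 by rewrite gcdp_eq0 (negPf d0) andbF.
have en := divpK (dvdp_gcdl n d); have ed := divpK (dvdp_gcdr n d).
have q0 : d %/ gcdp n d != 0 by apply: contraNneq d0 => h; rewrite -ed h mul0r.
exists (n %/ gcdp n d), (d %/ gcdp n d); split=> //.
  by rewrite coprimep_div_gcd // d0 orbT.
apply/eqP; rewrite eqr_div ?tofrac_eq0 // -!tofracM tofrac_eq.
by rewrite -[X in X * _ == _]en -[X in _ == _ * X]ed mulrAC mulrA.
Qed.

Lemma unital_represents f : unital 3 f ->
  exists2 i, (i < 84)%N & represents f (orbit_triple i).
Proof.
move=> [nc hf]; have [p [q hpq]] := lowest_terms_exists f.
have [q0 cpq ef] := hpq.
have qF0 : q%:F != 0 by rewrite tofrac_eq0.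
have cq : coprimep (q - p) q.
  rewrite coprimep_sym -{2}(mul1r q) coprimep_addl_mul.
  by rewrite (eqp_coprimepr _ (eqpNp p)) coprimep_sym.
have h1f : lowest_terms (1 - f) (q - p) q.
  by split => //; rewrite ef tofracB mulrBl divff.
have p0 : p != 0.
  by apply: contra_notN nc => /eqP p0; exists 0; rewrite ef p0 /rf_const !tofrac0 mul0r.
have r0 : q - p != 0.
  apply: contra_notN nc => /eqP /subr0_eq qp; exists 1.
  by rewrite ef -qp divff // /rf_const tofrac1.
have cpr : coprimep p (q - p).
  by rewrite addrC -mulN1r coprimep_addl_mul.
(* The numerator and denominator of [f], together with the numerator [q - p] of [1 - f], account for
   all the roots. *)
have hroot x : root (p * (q - p) * q) x -> x \in s.
  rewrite !rootM => /orP [/orP [] h|h]; apply/mem_s/hf.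
  - by left; exists p, q.
  - by right; right; left; exists (q - p), q.
  - by right; left; exists p, q.
have nt : ~ ((size p <= 1)%N /\ (size (q - p)%R <= 1)%N).
  move=> [sp sr]; apply: nc.
  have sq : (size q <= 1)%N.
    rewrite -(subrK p q); apply: leq_trans (size_polyD _ _) _.
    by rewrite geq_max sp sr.
  have c0 : q`_0 != 0 by apply: contraNneq q0 => c0; rewrite (size1_polyC sq) c0.
  exists (p`_0 / q`_0); rewrite ef; apply: (canLR (mulfK qF0)).
  rewrite /rf_const -tofracM (size1_polyC sp) [X in _ * X](size1_polyC sq).
  by rewrite !coefC eqxx -polyCM divfK.
(* There are four points in [s], so all sizes are at most 4 and all exponent sums at most 3, the
   bound in [vecs 4 3]. *)
have [sp sr sq] := mason_stothers (subrKC p q) p0 r0 q0 cpr cpq cq nt hroot.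
have rp x : root p x -> x \in s by move=> h; apply: hroot; rewrite !rootM h.
have rr x : root (q - p) x -> x \in s by move=> h; apply: hroot; rewrite !rootM h orbT.
have rq x : root q x -> x \in s by move=> h; apply: hroot; rewrite !rootM h orbT.
have [a sa ha] := eqp_mon p0 rp.
have [b sb hb] := eqp_mon r0 rr.
have [c sc hc] := eqp_mon q0 rq.
have rep : represents f (a, b, c) by exists p, (q - p), q; rewrite subrKC.
have vec e P : size e = 4%N -> P %= mon s e -> (size P <= 4)%N -> e \in vecs 4 3.
  by move=> se h; rewrite (eqp_size h) size_mon // => /mem_vecs; apply.
have adm : admissible (a, b, c).
  move: cpr cpq cq; rewrite (eqp_coprimepl _ ha) (eqp_coprimepr _ hb).
  rewrite (eqp_coprimepl _ ha) (eqp_coprimepr _ hc) (eqp_coprimepl _ hb).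
  rewrite (eqp_coprimepr _ hc) !coprimep_mon ?uniq_s // /= => -> -> -> /=.
  (* These bounds exclude that only [p] or only [q - p] is non-constant; [nt] excludes that only [q]
     is. Hence at least two exponent sums are positive. *)
  have max1 (P Q : {poly F}) : (size (P + Q)%R <= maxn (size P) (size Q))%N.
    exact: size_polyD.
  have := max1 q (- p); rewrite size_polyN.
  have := max1 q (- (q - p)); rewrite size_polyN opprB subrKC.
  move: nt; rewrite (eqp_size ha) (eqp_size hb) (eqp_size hc) !size_mon //.
  by case: (sumn a) (sumn b) (sumn c) => [|?] [|?] [|?] //= h; case: h.
have [i i84 e] := eis_dep_orbit_triple adm (eis_dep_mon w2 (subrKC p q) ha hb hc)
  (vec _ _ sa ha sp) (vec _ _ sb hb sr) (vec _ _ sc hc sq).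
by exists i => //; rewrite e.
Qed.

(** * The fourteen generators and the enumeration of their orbits *)

Definition generators : seq {fraction {poly F}} :=
  let x := rf_X F in
  let u := rf_const w in
  [:: x ^+ 3; rf_const (w ^+ 2) * (1 - x) / (x - u)] ++
  flatten [seq [:: e * x; (1 - u) / (e * x - u); (1 - u * e * x) / (1 - e * x);
                   - 3 * e * x / (e * x - 1) ^+ 2]
          | e <- [:: 1; u; rf_const (w ^+ 2)]].

(** Since [mon] is monic, the scalars [k], [l], [m] are the leading coefficients of [N], [D - N] and
    [D]. *)
Lemma represents_generator (k l m : F) N D a b c f :
  k != 0 -> l != 0 -> m != 0 -> N = k%:P * mon s a -> D - N = l%:P * mon s b ->
  D = m%:P * mon s c -> f = N%:F / D%:F -> represents f (a, b, c).
Proof.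
move=> k0 l0 m0 eN eDN eD ->; exists N, (D - N), D; split=> //.
- by rewrite subrKC.
- by rewrite eN mul_polyC eqp_scale.
- by rewrite eDN mul_polyC eqp_scale.
- by rewrite eD mul_polyC eqp_scale.
Qed.

Lemma monE a b c d : mon s [:: a; b; c; d] =
  'X ^+ a * ('X - 1) ^+ b * ('X - w%:P) ^+ c * ('X - w%:P ^+ 2) ^+ d.
Proof.
by rewrite /mon /= !big_cons big_nil /= subr0 rmorph1 rmorphXn mulr1 !mulrA.
Qed.

Lemma polyC_w2 : w%:P ^+ 2 = - w%:P - 1 :> {poly F}.
Proof. by rewrite -rmorphXn w2 rmorphB rmorphN rmorph1. Qed.

Lemma constants_neq0 : ((w == 0) = false) * ((w - 1 == 0) = false) *
  ((1 - w == 0) = false) * ((3 == 0 :> F) = false).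
Proof.
by rewrite !subr_eq0 pnatr_eq0 (eq_sym 1) (negPf w_neq0) (negPf w_neq1).
Qed.

Local Ltac nonzero :=
  by rewrite ?(oppr_eq0, mulf_eq0, expf_eq0) /= ?constants_neq0 ?oner_eq0.

Local Ltac generator k l m N D :=
  apply: (@represents_generator k l m N D);
  [ nonzero | nonzero | nonzero
  | rewrite monE; ring: polyC_w2 | rewrite monE; ring: polyC_w2
  | rewrite monE; ring: polyC_w2
  | by rewrite ?(tofracB, tofracN, tofracM, tofracXn, tofrac1, rmorph_nat) ?divr1 ].

Lemma generators_represent j : (j < 14)%N ->
  represents (nth 0 generators j) (nth ([::], [::], [::]) gen_triples j).
Proof.
case: j => [|[|[|[|[|[|[|[|[|[|[|[|[|[|j]]]]]]]]]]]]]] //= _.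
- generator (1 : F) (- 1 : F) (1 : F)
    ('X ^+ 3 : {poly F}) (1 : {poly F}).
- generator (- w ^+ 2) (- w) (1 : F)
    ((w ^+ 2)%:P * (1 - 'X)) ('X - w%:P).
- generator (1 : F) (- 1 : F) (1 : F)
    (1 * 'X : {poly F}) (1 : {poly F}).
- generator (1 - w) (1 : F) (1 : F)
    (1 - w%:P) (1 * 'X - w%:P).
- generator (- (w * 1)) ((w - 1) * 1) (- 1 : F)
    (1 - w%:P * 1 * 'X) (1 - 1 * 'X : {poly F}).
- generator (- (3 * 1) : F) (1 ^+ 2 : F) (1 ^+ 2 : F)
    (- 3 * 1 * 'X : {poly F}) ((1 * 'X - 1) ^+ 2 : {poly F}).
- generator w (- w : F) (1 : F)
    (w%:P * 'X : {poly F}) (1 : {poly F}).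
- generator (1 - w) w w
    (1 - w%:P) (w%:P * 'X - w%:P).
- generator (- (w * w)) ((w - 1) * w) (- w : F)
    (1 - w%:P * w%:P * 'X) (1 - w%:P * 'X : {poly F}).
- generator (- (3 * w) : F) (w ^+ 2 : F) (w ^+ 2 : F)
    (- 3 * w%:P * 'X : {poly F}) ((w%:P * 'X - 1) ^+ 2 : {poly F}).
- generator (w ^+ 2) (- (w ^+ 2) : F) (1 : F)
    ((w ^+ 2)%:P * 'X : {poly F}) (1 : {poly F}).
- generator (1 - w) (w ^+ 2) (w ^+ 2)
    (1 - w%:P) ((w ^+ 2)%:P * 'X - w%:P).
- generator (- (w * (w ^+ 2))) ((w - 1) * (w ^+ 2)) (- (w ^+ 2) : F)
    (1 - w%:P * (w ^+ 2)%:P * 'X) (1 - (w ^+ 2)%:P * 'X : {poly F}).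
- generator (- (3 * (w ^+ 2)) : F) ((w ^+ 2) ^+ 2 : F) ((w ^+ 2) ^+ 2 : F)
    (- 3 * (w ^+ 2)%:P * 'X : {poly F}) (((w ^+ 2)%:P * 'X - 1) ^+ 2 : {poly F}).
Qed.

Definition orbit_elt i : {fraction {poly F}} :=
  nth 0 (orbit6_seq (nth 0 generators (i %/ 6))) (i %% 6).

Lemma orbit6P f g : orbit6 f g <-> exists2 k, (k < 6)%N & nth 0 (orbit6_seq f) k = g.
Proof.
split.
  case=> [[[[[->|->]|->]|->]|->]|->];
    by [exists 0%N|exists 1%N|exists 2%N|exists 3%N|exists 4%N|exists 5%N].
rewrite /orbit6 /setU /=.
by case=> [[|[|[|[|[|[|k]]]]]]] //= _ <-; tauto.
Qed.

Lemma orbit_elt_image f :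
  (orbit_elt @` `I_84) f <-> exists2 g, g \in generators & orbit6 g f.
Proof.
split=> [[i /= i84 <-]|[g /(nthP 0) [j j14 <-] /orbit6P [k k6 <-]]].
  exists (nth 0 generators (i %/ 6)); first by rewrite mem_nth // ltn_divLR.
  by apply/orbit6P; exists (i %% 6)%N => //; rewrite ltn_mod.
exists (j * 6 + k)%N; first by rewrite /=; move: j14 => /=; lia.
by rewrite /orbit_elt divnMDl // divn_small // addn0 modnMDl modn_small.
Qed.

Lemma orbit_elt_represents i : (i < 84)%N -> represents (orbit_elt i) (orbit_triple i).
Proof.
move=> i84; apply: represents_orbit; last by rewrite ltn_mod.
by apply: generators_represent; rewrite ltn_divLR.
Qed.

(** A unital function shares its triple with some [orbit_elt j], and an admissible triple determines
    the function. *)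
Lemma unital_image : [set f | unital 3 f] = orbit_elt @` `I_84.
Proof.
apply/seteqP; split=> f /=.
  move=> /unital_represents [j j84 hf]; exists j => //.
  have := orbit_elt_represents j84; have := admissible_orbit_triple j84.
  case: (orbit_triple j) hf => [[a b] c] hf [adm sa sb sc] hj.
  exact: represents_fun adm _ _ hj hf.
move=> [j /= j84 <-]; have := orbit_elt_represents j84; have := admissible_orbit_triple j84.
by case: (orbit_triple j) => [[a b] c] [adm sa sb sc]; apply: represents_unital.
Qed.

(** Equal functions have equal triples, and the 84 triples are pairwise distinct; this makes the
    count exact. *)
Lemma orbit_elt_inj : {in `I_84 &, injective orbit_elt}.
Proof.
move=> i j; rewrite !inE /= => i84 j84 e.
have /mkseq_uniqP inj := uniq_orbit_triple; apply: inj => //.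
have hi := orbit_elt_represents i84; have := orbit_elt_represents j84.
rewrite -e => hj; have := admissible_orbit_triple i84; have := admissible_orbit_triple j84.
case: (orbit_triple i) hi => [[a b] c] hi; case: (orbit_triple j) hj => [[a' b'] c'] hj.
by move=> [adm' ? ? ?] [adm ? ? ?]; apply: represents_triple adm adm' hi hj.
Qed.

End Representation.

Lemma mem_cons (T : eqType) (x y : T) (r : seq T) : x \in r -> x \in y :: r.
Proof. by rewrite inE orbC => ->. Qed.

(** * The explicit cube root of unity *)

Section Zeta3.
Variable R : realType.

Lemma zeta3E : zeta3 R = Complex (cos (2 * pi / 3)) (sin (2 * pi / 3)).
Proof.
have -> : zeta3 R = cexp (Complex 0 (2 * pi / 3)).
  congr cexp; apply/eqP; rewrite eq_complex /=.
  apply/andP; split; apply/eqP; field;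
  by rewrite ?(addr0, expr0n) /= ?addr0 ?expf_neq0 // -?(natrD _ 1) pnatr_eq0.
by rewrite /cexp /= expR0 !mul1r.
Qed.

(** With [c = cos t] and [3 t = 2 pi], the triple angle formula gives [(c - 1) (2 c + 1)^2 = 0], and
    [c] is not 1 because [sin t > 0]. *)
Lemma cos_pi23 : cos (2 * pi / 3) = - 2^-1 :> R.
Proof.
set t := 2 * pi / 3.
have h : cos (t *+ 2 + t) = 1.
  by rewrite (_ : t *+ 2 + t = pi *+ 2) ?cos2pi // /t; field.
move: h; rewrite cosD cos_mulr2n sin_mulr2n => h.
have s1 := cos2Dsin2 t.
have st : 0 < sin t.
  apply: sin_gt0_pi; have := pi_gt0 R => p0; rewrite /t; apply/andP; split; lra.
have c1 : cos t - 1 != 0.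
  apply/eqP => e; have : sin t ^+ 2 = 0 by nra.
  by move/eqP; rewrite sqrf_eq0 gt_eqF.
have s2 : sin t ^+ 2 = 1 - cos t ^+ 2 by rewrite -s1; ring.
have : (cos t - 1) * (2 * cos t + 1) ^+ 2 = 0.
  by move/eqP: h; rewrite -subr_eq0 => /eqP <-; ring: s2.
move/eqP; rewrite mulf_eq0 (negPf c1) sqrf_eq0 /= => /eqP e.
lra.
Qed.

Lemma zeta3_sqr : zeta3 R ^+ 2 = - zeta3 R - 1.
Proof.
have := cos2Dsin2 (2 * pi / 3 : R); rewrite zeta3E cos_pi23 => h.
apply/eqP; rewrite eq_complex /=; apply/andP; split; apply/eqP; nra.
Qed.

Lemma conjc_zeta3 : conjc (zeta3 R) = zeta3 R ^+ 2.
Proof.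
rewrite zeta3_sqr zeta3E cos_pi23 /conjc /=.
by apply/eqP; rewrite eq_complex /=; apply/andP; split; apply/eqP; lra.
Qed.

End Zeta3.

Theorem theorem2p3 (R : realType) :
  ([set f : {fraction {poly R[i]}} | unital 3 f] #= `I_84)%card /\
  [set f : {fraction {poly R[i]}} | unital 3 f] = U3_list R.
Proof.
have w2 := zeta3_sqr R.
(* The cardinality is that of the index set, by injectivity of the enumeration; it remains to match
   the orbits of [generators] with the stated union. *)
rewrite (unital_image w2); split; first exact/inj_card_eq/orbit_elt_inj.
apply/seteqP; split=> f; rewrite /U3_list conjc_zeta3.
  move/orbit_elt_image => [g]; rewrite /generators mem_cat => /orP [|].
    by rewrite !inE => /orP [] /eqP -> h; left; [left|right].
  move=> /flatten_mapP [e]; rewrite !inE => he hg hf; right; exists e.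
    by move: he => /or3P [] /eqP -> /=; tauto.
  by move: hg hf => /or4P [] /eqP -> h; [left; left; left|left; left; right|left; right|right].
move=> h; apply/orbit_elt_image; rewrite /generators.
case: h => [[h|h]|[e he h]].
- by eexists; last exact: h; exact: mem_head.
- by eexists; last exact: h; apply: mem_cons; exact: mem_head.
have {}he : e \in [:: 1; rf_const (zeta3 R); rf_const (zeta3 R ^+ 2)].
  case: he => [[]|] ->.
  - exact: mem_head.
  - by apply: mem_cons; exact: mem_head.
  - by do 2! apply: mem_cons; exact: mem_head.
case: h => [[[h|h]|h]|h]; eexists; last 1 first; try exact: h.
all: rewrite mem_cat; apply/orP; right; apply/flatten_mapP; exists e; first exact: he.
- exact: mem_head.
- by apply: mem_cons; exact: mem_head.
- by do 2! apply: mem_cons; exact: mem_head.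
- by do 3! apply: mem_cons; exact: mem_head.
Qed.
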